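(* Let $\Sigma$ be a finite nonempty alphabet, $L\subseteq\Sigma^*$ and $\kappa(L)=n>1$. If $L$ is a two-sided ideal or a factor-closed language, then $\sigma(L)\le n^{n-2}+(n-2)2^{n-2}+1$. This bound is tight: for $n=2$ whenever $|\Sigma|\ge 2$, for $n=3$ whenever $|\Sigma|\ge 3$, for $n=4$ whenever $|\Sigma|\ge 5$, and for $n\ge 5$ whenever $|\Sigma|\ge 6$, there is a language over $\Sigma$ of the respective type with $\kappa(L)=n$ attaining the bound. Moreover, these alphabet sizes cannot be reduced.
   Context: For $L\subseteq\Sigma^*$ and $w\in\Sigma^*$, $w^{-1}L=\{x: wx\in L\}$; $\kappa(L)$ is the number of distinct such quotients (the number of states of a minimal DFA of $L$). The syntactic congruence: $x\approx_L y$ iff for all $u,v\in\Sigma^*$, $uxv\in L\Leftrightarrow uyv\in L$; $\sigma(L)$ is the cardinality of the syntactic semigroup $\Sigma^+/\approx_L$ (equivalently, of the transition semigroup of a minimal DFA of $L$). $L$ is a two-sided ideal if it is nonempty and $L=\Sigma^*L\Sigma^*$; $L$ is factor-closed if $w\in L$ implies every factor $x$ of $w$ (i.e. $w=uxv$) is in $L$. *)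

(* Defs.v *)
From mathcomp Require Import all_boot.
Set Implicit Arguments. Unset Strict Implicit. Unset Printing Implicit Defensive.

Definition language (S : finType) := seq S -> Prop.

Section Lang.
Variable S : finType.
Implicit Types (L : language S) (u v w x y : seq S).

Definition quot_eq L u v : Prop := forall x, L (u ++ x) <-> L (v ++ x).

(* kappa(L) = n : the set of distinct quotients w^{-1}L has exactly n elements,
   i.e. there are n words with pairwise distinct quotients and every quotient
   equals one of them. *)
Definition kappa_is L (n : nat) : Prop :=
  exists w : 'I_n -> seq S,
    (forall i j, quot_eq L (w i) (w j) -> i = j) /\
    (forall u, exists i, quot_eq L u (w i)).

Definition synt_cong L x y : Prop :=
  forall u v, L (u ++ x ++ v) <-> L (u ++ y ++ v).

(* sigma(L) = m : Sigma^+ / ~_L has exactly m classes. *)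
Definition sigma_is L (m : nat) : Prop :=
  exists w : 'I_m -> seq S,
    (forall i, w i <> [::]) /\
    (forall i j, synt_cong L (w i) (w j) -> i = j) /\
    (forall x, x <> [::] -> exists i, synt_cong L x (w i)).

Definition two_sided_ideal L : Prop :=
  (exists w, L w) /\
  (forall w, L w <-> exists u x v, w = u ++ x ++ v /\ L x).

Definition factor_closed L : Prop :=
  forall u x v, L (u ++ x ++ v) -> L x.

Definition lang_class (b : bool) L : Prop :=
  if b then two_sided_ideal L else factor_closed L.

End Lang.

Definition sigma_bound (n : nat) : nat := n ^ (n - 2) + (n - 2) * 2 ^ (n - 2) + 1.

Definition min_alpha (n : nat) : nat :=
  match n with 2 => 2 | 3 => 3 | 4 => 5 | _ => 6 end.

(* Main.v *)
Require Import Defs.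
From mathcomp Require Import all_boot all_fingroup zmodp ssralg boolp zify.
Set Implicit Arguments. Unset Strict Implicit. Unset Printing Implicit Defensive.

(* Complementation exchanges factor-closed languages and two-sided ideals, so
   let L be an ideal. Its n quotients, ordered by inclusion, form a poset with
   bottom L (the initial state) and top Sigma^* (the only accepting state), and
   words act on it by monotone maps fixing the top.

   Count these maps by the image c of the bottom, with u_c elements above c. If
   the n - 2 inner quotients form an antichain, the total is exactly the bound.
   If x < y are inner, exchanging the values at x and y shows that at most
   (u_c^(n-2) + u_c^(n-3)) / 2 maps send the bottom to c, and since sum_c h(u_c) is
   at most h(1) + ... + h(n) for nondecreasing h, the total is strictly below the bound.

   Hence the bound is attained only if the order is flat and every monotone map
   fixing the top is the action of a word. Generating all of them takes a
   generating set of the symmetric group on the inner quotients; a letter that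
   merges only an inner quotient with the bottom, one that merges only an inner
   quotient with the top, and one that merges only two inner quotients; and a
   letter moving the bottom to an inner quotient. These letters are distinct,
   except that for n = 3 the last one may be the one merging with the top.
   Conversely such letters generate all these maps. *)

(** * A power sum *)

(** The left side is six times the sum of the four leading terms of the binomial expansion of
    [k.+1 ^ (M + 3)]. *)
Lemma cubic_binomial_bound M k :
  k ^ M * (6 * k ^ 3 + 6 * (M + 3) * k ^ 2 + 3 * (M + 3) * (M + 2) * k
           + (M + 3) * (M + 2) * (M + 1)) <= 6 * k.+1 ^ (M + 3).
Proof.
elim: M => [|M IH]; first by lia.
rewrite addSn [k.+1 ^ _]expnS mulnCA; apply: leq_trans (leq_mul (leqnn k.+1) IH).
by rewrite expnS mulnCA [k * _]mulnC -mulnA leq_mul2l; apply/orP; right; lia.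
Qed.

(** Four binomial terms of [j.+1 ^ N] already suffice, which leaves a polynomial inequality. *)
Lemma power_ratio_bound N j : 7 <= N -> j <= N + 2 ->
  9 * (j ^ N * j.+1) <= 4 * (j.+1 ^ N * j.+2).
Proof.
move=> N7 jN; have [M MN] : exists M, N = M + 3 by exists (N - 3); lia.
have IH := cubic_binomial_bound M j.
have : 9 * (j ^ 3 * j.+1) * 6 <= 4 * (j.+2 *
   (6 * j ^ 3 + 6 * (M + 3) * j ^ 2 + 3 * (M + 3) * (M + 2) * j
           + (M + 3) * (M + 2) * (M + 1))).
  (* The polynomial grows with [M], so [M] may be lowered to [i + 4] with [i] the truncated
     difference [j - 9]. Either [j <= 9], a finite check, or [j = i + 9] and one variable
     remains. *)
  have [i [ji iM]] : exists i, j <= i + 9 /\ i + 4 <= M /\ (i = 0 \/ j = i + 9).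
    by exists (j - 9); lia.
  case: iM => iM ij.
  apply: (@leq_trans (4 * (j.+2 * (6 * j ^ 3 + 6 * (i + 7) * j ^ 2
     + 3 * (i + 7) * (i + 6) * j + (i + 7) * (i + 6) * (i + 5))))).
    case: ij => [i0|->]; last by nia.
    move: ji; rewrite i0; clear.
    by do 10?[case: j => [|j]; first by lia].
  by rewrite !leq_mul2l /= !leq_add ?leq_mul //; lia.
move: IH; set P := _ + _ * (M + 1) => IH PP.
rewrite MN {1}expnD -(leq_pmul2l (isT : 0 < 6)).
have := leq_mul (leqnn (j ^ M)) PP; have := leq_mul (leqnn (4 * j.+2)) IH.
move: (j ^ M) (j ^ 3) (j.+1 ^ (M + 3)) P {IH PP} => a b c P; lia.
Qed.

(* For [n >= 10] consecutive terms grow at least by the factor 9/4, so the sum is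
   at most 9/5 of its last term. *)
Lemma power_sum_bound n : 4 <= n ->
  \sum_(1 <= k < n.+1) (k ^ (n - 2) + k ^ (n - 3)) < 2 * sigma_bound n.
Proof.
move=> n4; rewrite /sigma_bound.
have [n9|n9] := leqP n 9.
  have {n4 n9} : n = 4 \/ n = 5 \/ n = 6 \/ n = 7 \/ n = 8 \/ n = 9 by lia.
  by case=> [|[|[|[|[|]]]]] ->; rewrite big_add1 big_mkord !big_ord_recr big_ord0
    !subSS !subn0 /=; lia.
have [N nN] : exists N, n = N + 3 by exists (n - 3); lia.
have S j : 1 <= j <= n ->
    5 * \sum_(1 <= k < j.+1) (k ^ N * k.+1) <= 9 * (j ^ N * j.+1).
  elim: j => // -[|j] IH jn; first by rewrite big_nat1 !exp1n.
  rewrite big_nat_recr //= mulnDr.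
  have := power_ratio_bound (N := N) (j := j.+1); lia.
have {}S := S n; rewrite (eq_bigr (fun k => k ^ N * k.+1)); last first.
  move=> k _; have -> : n - 2 = N.+1 by lia.
  have -> : n - 3 = N by lia.
  by rewrite expnS; lia.
have -> : n - 2 = N.+1 by lia.
rewrite expnS.
(* Here [n >= 10] gives [9 * (n + 1) < 10 * n]. *)
nia.
Qed.

(** * Monotone maps of a bounded poset *)

Lemma card_functions_in (T U : finType) (F : T -> {set U}) :
  #|[set t : {ffun T -> U} | [forall x, t x \in F x]]| = \prod_x #|F x|.
Proof.
rewrite -sum1_card (eq_bigl [in family F]); last first.
  by move=> t; rewrite inE; apply/forallP/familyP.
by rewrite sum1_card card_family foldrE big_map big_enum.
Qed.

Section BoundedPoset.

Variables (Q : finType) (le : rel Q) (o f : Q).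
Hypotheses (le_refl : reflexive le) (le_anti : antisymmetric le).
Hypotheses (le_tr : transitive le).
Hypotheses (le_o : forall x, le o x) (le_f : forall x, le x f) (o_neq_f : o != f).

Definition inner : {set Q} := ~: [set o; f].
Definition up (c : Q) : {set Q} := [set z | le c z].
Definition inner_antichain := forall x y, x \in inner -> y \in inner -> le x y -> x = y.

Definition mono_maps : {set {ffun Q -> Q}} :=
  [set t : {ffun Q -> Q} | (t f == f) && [forall x, forall y, le x y ==> le (t x) (t y)]].

Lemma mono_mapsP (t : {ffun Q -> Q}) :
  reflect (t f = f /\ (forall x y, le x y -> le (t x) (t y))) (t \in mono_maps).
Proof.
rewrite inE; apply: (iffP andP) => -[tf tm]; split; try exact/eqP.
  by move=> x y; move/forallP/(_ x)/forallP/(_ y)/implyP: tm.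
by apply/forallP=> x; apply/forallP=> y; apply/implyP; apply: tm.
Qed.

Definition upper_family (c x : Q) : {set Q} :=
  if x == o then [set c] else if x == f then [set f] else up c.

(** Of monotonicity only the comparisons with the bottom are kept, so the inner points choose their
    values in [up c] independently. *)
Definition upper_maps (c : Q) : {set {ffun Q -> Q}} :=
  [set t : {ffun Q -> Q} | [forall x, t x \in upper_family c x]].

Lemma upper_mapsP c (t : {ffun Q -> Q}) :
  reflect (forall x, t x \in upper_family c x) (t \in upper_maps c).
Proof. by rewrite inE; apply: forallP. Qed.

Lemma card_inner : #|inner| = #|Q| - 2.
Proof. by rewrite cardsCs setCK cards2 o_neq_f. Qed.

Lemma card_Q_gt1 : 1 < #|Q|.
Proof.
rewrite -cardsT (cardsD1 o) (cardsD1 f) !inE (eq_sym f) o_neq_f.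
by [].
Qed.

Lemma prod_inner (F : Q -> nat) : F o = 1 -> F f = 1 -> \prod_x F x = \prod_(x in inner) F x.
Proof.
move=> Fo Ff; rewrite [LHS](bigID [in inner]) /= [X in _ * X]big1 ?muln1 //.
by move=> x; rewrite !inE negbK => /orP[] /eqP ->.
Qed.

Lemma card_upper_maps c : #|upper_maps c| = #|up c| ^ (#|Q| - 2).
Proof.
rewrite card_functions_in prod_inner.
- rewrite -card_inner -prod_nat_const; apply: eq_bigr => x; rewrite !inE /upper_family.
  by rewrite negb_or => /andP[/negPf -> /negPf ->].
- by rewrite /upper_family eqxx cards1.
- by rewrite /upper_family eq_sym (negPf o_neq_f) eqxx cards1.
Qed.

Lemma mono_maps_sub_upper c : [set t : {ffun Q -> Q} in mono_maps | t o == c] \subset upper_maps c.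
Proof.
apply/subsetP=> t; rewrite 2!inE -andbA => /and3P[/eqP tf tm /eqP <-]; rewrite inE.
apply/forallP=> x; rewrite /upper_family; case: eqP => [->|_]; first by rewrite inE.
case: eqP => [->|_]; first by rewrite tf inE.
by rewrite inE; move/forallP/(_ o)/forallP/(_ x)/implyP: tm; apply.
Qed.

Lemma card_mono_maps_fibers :
  #|mono_maps| = \sum_c #|[set t : {ffun Q -> Q} in mono_maps | t o == c]|.
Proof.
rewrite -sum1_card (partition_big (fun t : {ffun Q -> Q} => t o) predT) //=.
by apply: eq_bigr => c _; rewrite -sum1_card; apply: eq_bigl => t; rewrite !inE.
Qed.

Lemma sum_Q (F : Q -> nat) : \sum_x F x = F o + \sum_(x in inner) F x + F f.
Proof.
rewrite (bigD1 o) //= (bigD1 f) //=; last by rewrite eq_sym.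
rewrite -addnA; congr (_ + _); rewrite addnC; congr (_ + _); apply: eq_bigl => x.
by rewrite !inE negb_or.
Qed.

Lemma card_up_o : #|up o| = #|Q|.
Proof. by rewrite -cardsT; apply: eq_card => x; rewrite !inE le_o. Qed.

Lemma card_up_f : #|up f| = 1.
Proof.
rewrite -(cards1 f); apply: eq_card => x; rewrite !inE.
apply/idP/eqP => [fx|->]; last exact: le_refl.
by apply: le_anti; rewrite fx le_f.
Qed.

(** * Counting over an antichain of inner elements *)

Section Antichain.
Hypothesis anti : inner_antichain.

Lemma card_up_inner c : c \in inner -> #|up c| = 2.
Proof.
move=> ic; have -> : up c = [set c; f].
  apply/setP=> x; rewrite !inE; apply/idP/orP=> [cx|[]/eqP-> //].
  have [->|xf] := eqVneq x f; first by right.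
  have [xo|xo] := eqVneq x o.
    left; apply/eqP; apply: le_anti; rewrite cx andbT; rewrite xo; exact: le_o.
  by left; rewrite (anti ic _ cx) // !inE negb_or xo.
rewrite cards2; move: ic; rewrite !inE negb_or => /andP[_ ->].
by [].
Qed.

(** All strict comparisons involve [o] or [f], and [upper_maps] already respects these. *)
Lemma mono_maps_antichain c : [set t : {ffun Q -> Q} in mono_maps | t o == c] = upper_maps c.
Proof.
apply/eqP; rewrite eqEsubset mono_maps_sub_upper /=; apply/subsetP=> t /upper_mapsP H.
have to : t o = c by apply/set1P; move: (H o); rewrite /upper_family eqxx.
have tf : t f = f.
  by apply/set1P; move: (H f); rewrite /upper_family eq_sym (negPf o_neq_f) eqxx.
have tc x : le c (t x).
  move: (H x); rewrite /upper_family; case: eqP => [->|_]; first by rewrite inE => /eqP ->.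
  by case: eqP => _; rewrite inE // => /eqP ->.
rewrite inE to eqxx andbT; apply/mono_mapsP; split=> // x y xy.
have [->|xo] := eqVneq x o; first by rewrite to.
have [->|yf] := eqVneq y f; first by rewrite tf.
have [yo|yo] := eqVneq y o.
  by case/eqP: xo; apply: le_anti; rewrite le_o andbT -yo.
have [xf|xf] := eqVneq x f.
  by case/eqP: yf; apply: le_anti; rewrite le_f -xf.
by rewrite (anti _ _ xy) // !inE negb_or ?xo ?yo.
Qed.

(** The up-sets of [o], of an inner element and of [f] have [n], 2 and 1 elements; each gives one
    summand of the bound. *)
Lemma card_mono_maps_antichain : #|mono_maps| = sigma_bound #|Q|.
Proof.
rewrite card_mono_maps_fibers sum_Q !mono_maps_antichain !card_upper_maps.
rewrite card_up_o card_up_f exp1n /sigma_bound; congr (_ + _ + _).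
rewrite -card_inner -sum_nat_const; apply: eq_bigr => c ic.
by rewrite mono_maps_antichain card_upper_maps card_up_inner // card_inner.
Qed.
End Antichain.

(** * Counting with two comparable inner elements *)

Section Comparable.
Variables (x y : Q).
Hypotheses (ix : x \in inner) (iy : y \in inner) (xy : le x y) (x_neq_y : x != y).

Let xo : (x == o) = false. Proof. by move: ix; rewrite !inE negb_or => /andP[/negPf]. Qed.
Let xf : (x == f) = false. Proof. by move: ix; rewrite !inE negb_or => /andP[_ /negPf]. Qed.
Let yo : (y == o) = false. Proof. by move: iy; rewrite !inE negb_or => /andP[/negPf]. Qed.
Let yf : (y == f) = false. Proof. by move: iy; rewrite !inE negb_or => /andP[_ /negPf]. Qed.

Lemma card_Q_ge4 : 3 < #|Q|.
Proof.
have : #|[set x; y]| <= #|inner|.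
  by apply/subset_leq_card/subsetP=> z; rewrite in_set2 => /orP[] /eqP ->.
by rewrite cards2 x_neq_y card_inner; lia.
Qed.

(** The value at [x] can be recovered from the one at [y], so overwriting it by [f] is injective and
    leaves [#|Q| - 3] free choices. *)
Lemma card_upper_maps_eq c :
  #|[set t : {ffun Q -> Q} in upper_maps c | t x == t y]| <= #|up c| ^ (#|Q| - 3).
Proof.
pose F z := if z == x then [set f] else upper_family c z.
pose h (t : {ffun Q -> Q}) := [ffun z => if z == x then f else t z].
have -> : #|up c| ^ (#|Q| - 3) = #|[set t : {ffun Q -> Q} | [forall z, t z \in F z]]|.
  rewrite card_functions_in prod_inner.
  - rewrite (bigD1 x) //= {1}/F eqxx cards1 mul1n.
    have -> : #|Q| - 3 = #|inner :\ x|.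
      by have := cardsD1 x inner; rewrite ix card_inner; lia.
    rewrite -prod_nat_const; apply: eq_big => z; first by rewrite !inE andbC.
    rewrite /F !inE /upper_family negb_or.
    by move=> /and3P[/negPf -> /negPf -> /negPf ->].
  - by rewrite /F eq_sym xo /upper_family eqxx cards1.
  - by rewrite /F eq_sym xf /upper_family eq_sym (negPf o_neq_f) eqxx cards1.
rewrite -(card_in_imset (f := h)).
  apply/subset_leq_card/subsetP=> _ /imsetP[t + ->]; rewrite inE => /andP[/upper_mapsP tu _].
  rewrite inE; apply/forallP=> z; rewrite ffunE /F; case: eqP => _; first by rewrite inE.
  exact: tu.
move=> t u; rewrite !inE => /andP[_ /eqP tE] /andP[_ /eqP uE] /ffunP E.
have E' z : z != x -> t z = u z by move=> zx; move: (E z); rewrite !ffunE (negPf zx).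
apply/ffunP=> z; have [->|/E'//] := eqVneq z x.
by rewrite tE uE; apply: E'; rewrite eq_sym.
Qed.

(* Precomposing with the transposition of [x] and [y] sends the maps with
   [t x < t y] to maps violating monotonicity. *)
Lemma card_mono_maps_fiber c :
  2 * #|[set t : {ffun Q -> Q} in mono_maps | t o == c]|
    <= #|up c| ^ (#|Q| - 2) + #|up c| ^ (#|Q| - 3).
Proof.
rewrite -card_upper_maps.
set F := upper_maps c; set W := [set t in _ | _].
pose E := [set t : {ffun Q -> Q} in F | t x == t y].
pose h (t : {ffun Q -> Q}) : {ffun Q -> Q} := [ffun z => t (tperm x y z)].
have hinj : injective h.
  move=> t u /ffunP tu; apply/ffunP=> z; move: (tu (tperm x y z)).
  by rewrite !ffunE tpermK.
have hle : #|W :\: E| <= #|F :\: W|.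
  rewrite -(card_imset _ hinj); apply/subset_leq_card/subsetP=> _ /imsetP[t + ->].
  rewrite in_setD => /andP[tE tW]; have tF : t \in F.
    by apply: subsetP tW; apply: mono_maps_sub_upper.
  move: tE; rewrite inE tF /= => txy.
  have lt_txy : le (t x) (t y).
    by move: tW; rewrite inE => /andP[/mono_mapsP[_ tm] _]; apply: tm.
  rewrite in_setD; apply/andP; split.
    apply/negP; rewrite inE => /andP[/mono_mapsP[_ hm] _].
    move: (hm _ _ xy); rewrite !ffunE tpermL tpermR => le_tyx.
    by case/eqP: txy; apply: le_anti; rewrite lt_txy.
  move/upper_mapsP: tF => tF; apply/upper_mapsP=> z; rewrite ffunE.
  case: tpermP => [->|->|_ _] //.
    by move: (tF y); rewrite /upper_family xo xf yo yf.
  by move: (tF x); rewrite /upper_family xo xf yo yf.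
have WF : W \subset F := mono_maps_sub_upper c.
have WE : #|W :&: E| <= #|up c| ^ (#|Q| - 3).
  by apply: leq_trans (card_upper_maps_eq c); apply/subset_leq_card/subsetIr.
have := cardsID E W; have := cardsID W F; rewrite (setIidPr WF).
by move=> FD WD; rewrite mul2n -addnn -FD -addnA leq_add2l -WD addnC leq_add.
Qed.

(** Remove a minimal element [c0] of [A]: its own term is at most [h #|A|], and it lies in no other
    up-set, so the other terms are unchanged in [A :\ c0]. *)
Lemma sum_up_bound (h : nat -> nat) (A : {set Q}) : {homo h : a b / a <= b} ->
  \sum_(c in A) h #|up c :&: A| <= \sum_(1 <= k < #|A|.+1) h k.
Proof.
move=> hh; move cA: #|A| => k; elim: k A cA => [|k IH] A cA.
  by rewrite (cards0_eq cA) big_set0.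
have [c0 c0A cmin] : exists2 c, c \in A & forall z, z \in A -> le z c -> z = c.
  have /set0Pn[z0 z0A] : A != set0 by rewrite -cards_eq0 cA.
  (* An element with the fewest elements of [A] below it is minimal. *)
  pose d z := #|[set w in A | le w z]|.
  case: (arg_minnP d z0A) => c; rewrite -/(c \in A) => cIn cmin; exists c => // z zA zc.
  apply/eqP; apply: contraTT (cmin z zA) => zc'; rewrite -ltnNge.
  apply: proper_card; apply/properP; split.
    by apply/subsetP=> w; rewrite !inE => /andP[-> wz]; apply: le_tr zc.
  exists c; rewrite !inE cIn ?le_refl //=; apply: contra zc' => cz.
  by apply/eqP/le_anti; rewrite zc.
rewrite (big_setD1 c0) //= big_nat_recr //= addnC leq_add //; last first.
  by apply: hh; rewrite -cA; apply/subset_leq_card/subsetIr.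
rewrite (leq_trans _ (IH (A :\ c0) _)) //; last by move: (cardsD1 c0 A); rewrite c0A; lia.
apply: leq_sum => c; rewrite !inE => /andP[cc0 cA']; apply: hh; apply: subset_leq_card.
apply/subsetP=> z; rewrite !inE => /andP[cz ->]; rewrite cz !andbT.
by apply: contra cc0 => /eqP zc0; rewrite (cmin _ cA') // -zc0.
Qed.

Lemma card_mono_maps_comparable : #|mono_maps| < sigma_bound #|Q|.
Proof.
rewrite -(ltn_pmul2l (isT : 0 < 2)); apply: leq_ltn_trans (power_sum_bound card_Q_ge4).
rewrite card_mono_maps_fibers big_distrr /=.
pose h k := k ^ (#|Q| - 2) + k ^ (#|Q| - 3).
have hh : {homo h : a b / a <= b}.
  by move=> a b ab; rewrite leq_add ?leq_exp2r //; have := card_Q_ge4; lia.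
have := sum_up_bound setT hh; rewrite cardsT; apply: leq_trans.
rewrite [leqRHS](eq_bigl predT) => [|c]; last by rewrite inE.
by apply: leq_sum => c _; rewrite setIT; apply: card_mono_maps_fiber.
Qed.
End Comparable.

Lemma card_mono_maps_le : #|mono_maps| <= sigma_bound #|Q|.
Proof.
case: (pselect inner_antichain) => [/card_mono_maps_antichain -> //|].
case/existsNP=> x /existsNP[y] /not_implyP[ix] /not_implyP[iy] /not_implyP[xy] /eqP nxy.
by apply: ltnW; apply: card_mono_maps_comparable xy nxy.
Qed.

Lemma mono_maps_extremal : #|mono_maps| = sigma_bound #|Q| -> inner_antichain.
Proof.
move=> E x y ix iy xy; apply/eqP; apply/negPn/negP=> nxy.
by have := card_mono_maps_comparable ix iy xy nxy; rewrite E ltnn.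
Qed.

End BoundedPoset.

(** * Minimal automata *)

Section Automaton.

Variables (S Q : finType) (d : S -> {ffun Q -> Q}).
Implicit Types (x y w : seq S) (q : Q).

Definition run x q : Q := foldl (fun p a => d a p) q x.
Definition trans x : {ffun Q -> Q} := [ffun q => run x q].
(** As in [sigma_is], only nonempty words count: the identity belongs to it only if some nonempty
    word acts trivially. *)
Definition trans_semigroup : {set {ffun Q -> Q}} :=
  [set t | `[< exists2 x, x <> [::] & t = trans x >]].

Lemma run_cat x y q : run (x ++ y) q = run y (run x q).
Proof. exact: foldl_cat. Qed.

Lemma trans_semigroupP (t : {ffun Q -> Q}) :
  reflect (exists2 x, x <> [::] & t = trans x) (t \in trans_semigroup).
Proof. by rewrite inE; apply: asboolP. Qed.

Definition minimal_dfa (L : language S) (o : Q) (F : {set Q}) : Prop :=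
  [/\ forall w, L w <-> run w o \in F,
      forall q, exists w, run w o = q
    & forall p q, (forall x, (run x p \in F) = (run x q \in F)) -> p = q].

Variables (L : language S) (o : Q) (F : {set Q}).
Hypothesis dfaL : minimal_dfa L o F.

(** Reachability lets the left context start from any state, and reducedness turns equal acceptance
    under all right contexts into equality of states. *)
Lemma synt_cong_trans x y : synt_cong L x y <-> trans x = trans y.
Proof.
case: dfaL => LF acc red; split=> [xy|/ffunP xy u v]; last first.
  by rewrite !LF !run_cat; move: (xy (run u o)); rewrite !ffunE => ->.
apply/ffunP=> q; rewrite !ffunE; have [u <-] := acc q.
apply: red => v; rewrite -!run_cat -?catA.
by apply/idP/idP => /LF/xy/LF.
Qed.

Lemma quot_eq_run u v : quot_eq L u v <-> run u o = run v o.
Proof.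
case: dfaL => LF acc red; split=> [uv|uv x]; last by rewrite !LF !run_cat uv.
by apply: red => x; rewrite -!run_cat; apply/idP/idP => /LF/uv/LF.
Qed.

Lemma minimal_dfa_kappa : kappa_is L #|Q|.
Proof.
case: dfaL => _ acc _; exists (fun i => projT1 (cid (acc (enum_val i)))); split.
  move=> i j /quot_eq_run; case: cid => u /= ->; case: cid => v /= ->.
  exact: enum_val_inj.
move=> u; exists (enum_rank (run u o)); apply/quot_eq_run.
by case: cid => v /= ->; rewrite enum_rankK.
Qed.

Lemma minimal_dfa_sigma m : sigma_is L m <-> #|trans_semigroup| = m.
Proof.
split=> [[w [w0 [winj wall]]]|<-].
  have tinj : injective (fun i => trans (w i)) by move=> i j /synt_cong_trans/winj.
  rewrite -[m in RHS]card_ord -(card_imset _ tinj); congr #|pred_of_set _|.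
  apply/setP=> t; apply/trans_semigroupP/imsetP => [[x x0 ->]|[i _ ->]]; last by exists (w i).
  by have [i /synt_cong_trans xi] := wall x x0; exists i.
have H (i : 'I_#|trans_semigroup|) : exists x, x <> [::] /\ enum_val i = trans x.
  by have /trans_semigroupP[x x0 xE] := enum_valP i; exists x.
exists (fun i => projT1 (cid (H i))); split; first by move=> i; case: cid => x [].
split.
  move=> i j /synt_cong_trans; case: cid => u [_ /= <-]; case: cid => v [_ /= <-].
  exact: enum_val_inj.
move=> x x0; have xT : trans x \in trans_semigroup by apply/trans_semigroupP; exists x.
exists (enum_rank_in xT (trans x)); apply/synt_cong_trans.
by case: cid => y [_ /= <-]; rewrite enum_rankK_in.
Qed.

End Automaton.

(** States are the indices of the representatives [w i], and [a] sends [i] to the index of the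
    quotient by [rcons (w i) a]. *)
Lemma kappa_minimal_dfa (S : finType) (L : language S) n : kappa_is L n ->
  exists (d : S -> {ffun 'I_n -> 'I_n}) (o : 'I_n) (F : {set 'I_n}), minimal_dfa d L o F.
Proof.
case=> w [winj wall]; pose q u := projT1 (cid (wall u)).
have qP u : quot_eq L u (w (q u)) by rewrite /q; case: cid.
pose d a : {ffun 'I_n -> 'I_n} := [ffun i => q (rcons (w i) a)].
have runP x i : quot_eq L (w i ++ x) (w (run d x i)).
  elim: x i => [|a x IH] i y; first by rewrite cats0.
  rewrite /= -IH -cat_rcons -catA ffunE (qP _ (x ++ y)) catA.
  by [].
have run_o x : quot_eq L x (w (run d x (q [::]))).
  by move=> y; rewrite -runP -catA -(qP [::] (x ++ y)).
exists d, (q [::]), [set i | `[< L (w i) >]]; split=> [x|i|i j ij].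
- have := run_o x [::]; rewrite !cats0 inE => xE.
  by rewrite xE; split=> /asboolP.
- by exists (w i); apply: winj => y; apply: iff_sym; apply: run_o.
- apply: winj => x; rewrite -[in X in X <-> _](cats0 x) -[in X in _ <-> X](cats0 x) !catA.
  rewrite !runP !cats0; move: (ij x); rewrite !inE => E.
  by split=> /asboolP Lx; apply/asboolP; rewrite ?E // -E.
Qed.

(** * The inclusion order on the quotients of an ideal *)

Section IdealDfa.

Variables (S Q : finType) (d : S -> {ffun Q -> Q}) (L : language S) (o : Q) (F : {set Q}).
Hypotheses (dfaL : minimal_dfa d L o F) (idealL : two_sided_ideal L).

Definition quot_le : rel Q :=
  fun p q => `[< forall x, run d x p \in F -> run d x q \in F >].

Lemma quot_le_refl : reflexive quot_le.
Proof. by move=> p; apply/asboolP. Qed.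

Lemma quot_le_anti : antisymmetric quot_le.
Proof.
move=> p q /andP[/asboolP pq /asboolP qp]; case: dfaL => _ _; apply=> x.
by apply/idP/idP => [/pq|/qp].
Qed.

Lemma quot_le_trans : transitive quot_le.
Proof. by move=> q p r /asboolP pq /asboolP qr; apply/asboolP=> x /pq/qr. Qed.

Lemma ideal_cat u x v : L x -> L (u ++ x ++ v).
Proof. by case: idealL => _ H Lx; apply/H; exists u, x, v. Qed.

Lemma quot_le_initial q : quot_le o q.
Proof.
case: dfaL => LF acc _; have [w <-] := acc q; apply/asboolP=> x /LF Lx.
by rewrite -run_cat; apply/LF; rewrite -[x]cats0; apply: ideal_cat.
Qed.

Lemma quot_le_run x p q : quot_le p q -> quot_le (run d x p) (run d x q).
Proof. by move=> /asboolP pq; apply/asboolP=> y; rewrite -!run_cat; apply: pq. Qed.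

(** Every continuation of a word of [L] is in [L], so all accepting states have the full quotient,
    and reducedness identifies them. *)
Lemma ideal_top : exists2 f, F = [set f] & forall q, quot_le q f.
Proof.
case: dfaL => LF acc red; case: idealL => -[w Lw] _.
have Lx u x : L u -> L (u ++ x) by move=> Lu; apply: (@ideal_cat [::]).
have sat p q : p \in F -> quot_le q p.
  have [u <-] := acc p => /LF Lu; apply/asboolP=> x _.
  by rewrite -run_cat; apply/LF/Lx.
have wF : run d w o \in F by apply/LF.
exists (run d w o) => [|q]; last exact: sat.
apply/setP=> q; rewrite inE; apply/idP/eqP => [qF|-> //].
by apply: quot_le_anti; rewrite !sat.
Qed.

End IdealDfa.

(** * Letters needed to generate all monotone maps *)

Section GeneratorCount.

Variables (Q : finType) (le : rel Q) (o f : Q).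
Hypotheses (le_refl : reflexive le) (le_anti : antisymmetric le).
Hypotheses (le_o : forall x, le o x) (le_f : forall x, le x f) (o_neq_f : o != f).
Hypothesis anti : inner_antichain le o f.

Let innerE x : (x \in inner o f) = (x != o) && (x != f).
Proof. by rewrite !inE negb_or. Qed.

Lemma mono_maps_fix (t : {ffun Q -> Q}) : t o = o -> t f = f -> t \in mono_maps le f.
Proof.
move=> to tf; suff: t \in [set t : {ffun Q -> Q} in mono_maps le f | t o == o].
  by rewrite inE => /andP[].
rewrite mono_maps_antichain //; apply/upper_mapsP=> x; rewrite /upper_family.
by case: eqP => [->|_]; [rewrite inE to | case: eqP => [->|_]; rewrite inE ?tf].
Qed.

Lemma mono_maps_two_valued (t : {ffun Q -> Q}) i : i \in inner o f -> t f = f -> t o = i ->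
  (forall x, t x = i \/ t x = f) -> t \in mono_maps le f.
Proof.
move=> ii tf to tif; suff: t \in [set t : {ffun Q -> Q} in mono_maps le f | t o == i].
  by rewrite inE => /andP[].
rewrite mono_maps_antichain //; apply/upper_mapsP=> x; rewrite /upper_family.
case: eqP => [->|_]; first by rewrite inE to.
by case: eqP => [->|_]; rewrite inE ?tf //; have [->|->] := tif x.
Qed.

Lemma mono_maps_const_f : [ffun=> f] \in mono_maps le f.
Proof. by apply/mono_mapsP; rewrite ffunE; split=> // x y _; rewrite !ffunE. Qed.

(** Every value lies above [t o], and above an inner element there is only itself and the top. *)
Lemma mono_maps_inner_image (t : {ffun Q -> Q}) x : t \in mono_maps le f ->
  t o \in inner o f -> t x = t o \/ t x = f.
Proof.
case/mono_mapsP=> tf tm ito; have [->|xf] := eqVneq (t x) f; first by right.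
left; apply/esym/anti => //; last exact: tm.
rewrite innerE xf andbT; apply/eqP=> xo; move: (tm _ _ (le_o x)); rewrite xo => too.
have {}too : t o = o by apply: le_anti; rewrite too le_o.
by move: ito; rewrite innerE too eqxx.
Qed.

(** On a finite set [t] is onto, so some [z] is sent to [o]; then [t o] lies below [t z = o]. *)
Lemma mono_maps_inj_fix (t : {ffun Q -> Q}) : t \in mono_maps le f -> injective t -> t o = o.
Proof.
case/mono_mapsP=> tf tm tinj; have /codomP[z zE] := inj_card_onto tinj (leqnn _) o.
by apply: le_anti; rewrite le_o {1}[in X in le _ X]zE tm.
Qed.

(** The kernel of [t] has one nontrivial class, the unordered pair of [p] and [q]. *)
Definition merges_only (t : {ffun Q -> Q}) (p q : Q) : Prop :=
  [/\ p != q, t p = t q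
    & forall x y, t x = t y -> [\/ x = y, x = p /\ y = q | x = q /\ y = p]].

Definition redirect (x y : Q) : {ffun Q -> Q} := [ffun z => if z == x then y else z].

Lemma merges_only_redirect x y : x != y -> merges_only (redirect x y) y x.
Proof.
move=> xy; split; rewrite ?ffunE ?eqxx ?(eq_sym y) ?(negPf xy) //.
move=> a b; rewrite !ffunE; case: eqP => [->|_]; case: eqP => [->|_] E.
- by constructor 1.
- by constructor 3.
- by constructor 2.
- by constructor 1.
Qed.

(** The merged pair is unique up to order, and if the order is swapped then [p] and [p'] are both
    inner. Letters merging pairs of different kinds are thereby told apart. *)
Lemma merges_only_same_kind t p q p' q' : q \in inner o f -> q' \in inner o f ->
  merges_only t p q -> merges_only t p' q' -> ((p == o) = (p' == o)) * ((p == f) = (p' == f)).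
Proof.
rewrite !innerE => /andP[/negPf qo /negPf qf] /andP[/negPf qo' /negPf qf'].
case=> pq E _ [_ _] /(_ _ _ E) [|[-> _] //|[-> <-]]; last by rewrite qo qf qo' qf'.
by move/eqP: pq.
Qed.

Variables (S : finType) (d : S -> {ffun Q -> Q}).
Hypothesis full : trans_semigroup d = mono_maps le f.

Lemma letter_mono a : d a \in mono_maps le f.
Proof.
rewrite -full; apply/trans_semigroupP; exists [:: a] => //.
by apply/ffunP=> q; rewrite ffunE.
Qed.

Lemma mono_word (t : {ffun Q -> Q}) : t \in mono_maps le f ->
  exists2 x, x <> [::] & t =1 run d x.
Proof.
rewrite -full => /trans_semigroupP[x x0 ->]; exists x => // q.
by rewrite ffunE.
Qed.

Lemma run_inj_cons a x : injective (run d (a :: x)) ->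
  injective (d a) /\ injective (run d x).
Proof.
move=> inj; have ia : injective (d a) by move=> p q pq; apply: inj; rewrite /= pq.
split=> // p q.
have /codomP[p' ->] := inj_card_onto ia (leqnn _) p.
have /codomP[q' ->] := inj_card_onto ia (leqnn _) q.
by move=> E; congr (d a _); apply: inj.
Qed.

Lemma run_inj_letters x a : injective (run d x) -> a \in x -> injective (d a).
Proof.
elim: x => //= b x IH /run_inj_cons[ib ix]; rewrite inE => /orP[/eqP -> //|].
exact: IH.
Qed.

Lemma injective_letter : exists a, injective (d a).
Proof.
have /mono_word[[//|a x] _ xE] : [ffun q => q] \in mono_maps le f.
  by apply: mono_maps_fix; rewrite ffunE.
exists a; apply: (proj1 (run_inj_cons (x := x) _)) => p q.
by rewrite -!xE !ffunE.
Qed.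

(* With a single injective letter the invertible maps would commute. *)
Lemma two_injective_letters : 2 < #|inner o f| ->
  exists a b, [/\ a != b, injective (d a) & injective (d b)].
Proof.
case/card_gt2P=> p [q [r [[ip iq ir] [pq qr rp]]]].
have [a ia] := injective_letter.
case: (pselect (exists2 b, a != b & injective (d b))) => [[b ab ib]|H].
  by exists a, b.
have only b : injective (d b) -> b = a.
  by move=> ib; apply/eqP; rewrite eq_sym; apply/negPn/negP=> ab; apply: H; exists b.
(* A word acting as a permutation has only injective letters, so it is a power of [a]. *)
have tp u v : u \in inner o f -> v \in inner o f ->
    exists k, forall z, tperm u v z = run d (nseq k a) z.
  rewrite !innerE => /andP[uo uf] /andP[vo vf].
  have /mono_word[x _ xE] : [ffun z => tperm u v z] \in mono_maps le f.
    by apply: mono_maps_fix; rewrite ffunE tpermD.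
  have xE' z : tperm u v z = run d x z by rewrite -xE ffunE.
  have xinj : injective (run d x) by move=> z z'; rewrite -!xE' => /perm_inj.
  exists (size x) => z; rewrite xE'; congr (run d _ z); apply/all_pred1P/allP=> b bx.
  by apply/eqP/only; apply: run_inj_letters bx.
have [k kE] := tp _ _ ip iq; have [l lE] := tp _ _ iq ir.
have : run d (nseq k a ++ nseq l a) p = run d (nseq l a ++ nseq k a) p.
  by rewrite -!nseqD addnC.
have D : tperm q r p = p by rewrite tpermD // eq_sym.
rewrite !run_cat -!kE -!lE D !tpermL => /eqP.
by rewrite eq_sym (negPf qr).
Qed.

(** Injective letters permute the states and fix [o] and [f], so they carry the pair to one of the
    same kind. The first letter that is not injective can merge only the pair carried so far. *)
Lemma merging_word x p q : q \in inner o f -> merges_only (trans d x) p q ->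
  exists a p' q', [/\ merges_only (d a) p' q', q' \in inner o f,
    (p' == o) = (p == o) & (p' == f) = (p == f)].
Proof.
elim: x p q => [|a x IH] p q iq [pq E only].
  by move: E pq; rewrite !ffunE /= => ->; rewrite eqxx.
case: (pselect (injective (d a))) => [ia|nia]; last first.
  exists a, p, q; split=> //; split=> //; last first.
    by move=> u v uv; apply: only; rewrite !ffunE /= uv.
  have [u [v [uv nuv]]] : exists u v, d a u = d a v /\ u <> v.
    by apply: contrapT => H; apply: nia => u v uv; apply: contrapT => nuv; apply: H; exists u, v.
  by case: (only u v); rewrite ?ffunE /= ?uv // => -[<- <-].
have ao : d a o = o := mono_maps_inj_fix (letter_mono a) ia.
have af : d a f = f by case/mono_mapsP: (letter_mono a).
have eqo z : (d a z == o) = (z == o) by rewrite -{1}ao (inj_eq ia).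
have eqf z : (d a z == f) = (z == f) by rewrite -{1}af (inj_eq ia).
rewrite -eqo -(eqf p); apply: (IH _ (d a q)); first by rewrite innerE eqo eqf -innerE.
split; first by rewrite (inj_eq ia).
  by move: E; rewrite !ffunE.
move=> u v; have /codomP[u' ->] := inj_card_onto ia (leqnn _) u.
have /codomP[v' ->] := inj_card_onto ia (leqnn _) v; rewrite !ffunE => uv.
case: (only u' v'); rewrite ?ffunE //.
- by move=> ->; constructor 1.
- by case=> -> ->; constructor 2.
- by case=> -> ->; constructor 3.
Qed.

Lemma merging_letter q p : q \in inner o f -> q != p ->
  exists a p' q', [/\ merges_only (d a) p' q', q' \in inner o f,
    (p' == o) = (p == o) & (p' == f) = (p == f)].
Proof.
move=> iq qp; have /andP[qo qf] : (q != o) && (q != f) by rewrite -innerE.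
have /mono_word[x _ xE] : redirect q p \in mono_maps le f.
  by apply: mono_maps_fix; rewrite ffunE eq_sym ?(negPf qo) ?(negPf qf).
apply: (@merging_word x p q) => //; have <- : redirect q p = trans d x.
  by apply/ffunP=> z; rewrite xE ffunE.
exact: merges_only_redirect.
Qed.

(** Otherwise all letters preserve the set of [o] and [f], and no word sends [o] to [i]. *)
Lemma lifting_letter i : i \in inner o f -> exists a, d a o \in inner o f.
Proof.
move=> ii; apply: contrapT => H.
have Ho a : d a o = o \/ d a o = f.
  have: d a o \notin inner o f by apply/negP=> ia; apply: H; exists a.
  by rewrite innerE negb_and !negbK => /orP[]/eqP; [left|right].
have runo x : forall p, p = o \/ p = f -> run d x p = o \/ run d x p = f.
  elim: x => //= a x IH p [] ->; apply: IH => //; right.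
  by case/mono_mapsP: (letter_mono a).
have /mono_word[x _ xE] : [ffun z => if z == f then f else i] \in mono_maps le f.
  apply: (@mono_maps_two_valued _ i) => // [||z]; rewrite ffunE ?eqxx ?(negPf o_neq_f) //.
  by case: eqP; [right|left].
move: ii; rewrite innerE; have := runo x o (or_introl erefl).
by rewrite -xE ffunE (negPf o_neq_f) => -[] ->; rewrite eqxx ?andbF.
Qed.

(** If [d a o] is inner, the only values are [d a o] and [f], so each inner state is merged with [o]
    or [f]; two inner states then give two merged pairs. *)
Lemma merges_only_fix_o a p q : 1 < #|inner o f| -> merges_only (d a) p q ->
  d a o \notin inner o f.
Proof.
case/card_gt1P=> r [s [ir is' rs]] [pq E only]; apply/negP=> io.
have af : d a f = f by case/mono_mapsP: (letter_mono a).
have pair z : z \in inner o f -> exists2 w, w \notin inner o f & d a z = d a w.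
  move=> iz; case: (mono_maps_inner_image z (letter_mono a) io) => ->.
    by exists o => //; rewrite innerE eqxx.
  by exists f; rewrite ?af // innerE eqxx andbF.
have half z : z \in inner o f ->
    exists2 w, w \notin inner o f & (z = p /\ w = q) \/ (z = q /\ w = p).
  move=> iz; have [w iw /only[zw|zw|zw]] := pair z iz; last 2 first.
  - by exists w; [|left].
  - by exists w; [|right].
  by move: iw; rewrite -zw iz.
have [w iw [[rp wq]|[rq wp]]] := half r ir; have [w' iw' [[sp wq']|[sq wp']]] := half s is'.
- by rewrite rp sp eqxx in rs.
- by move: iw; rewrite wq -sq is'.
- by move: iw; rewrite wp -sp is'.
- by rewrite rq sq eqxx in rs.
Qed.

Lemma min_alpha_le_letters : min_alpha #|Q| <= #|S|.
Proof.
have uniq_le (s : seq S) : uniq s -> size s <= #|S|.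
  by move=> us; rewrite -(card_uniqP us) max_card.
have inj_not_merges a p q : injective (d a) -> ~ merges_only (d a) p q.
  by move=> ia [/eqP pq /ia].
have inj_fix a : injective (d a) -> d a o = o := mono_maps_inj_fix (letter_mono a).
have cQ : #|inner o f| = #|Q| - 2 by apply: card_inner.
have Q1 : 1 < #|Q| := card_Q_gt1 o_neq_f.
have E2 : #|Q| <= 2 -> #|Q| = 2 by lia.
have E3 : 2 < #|Q| -> #|Q| <= 3 -> #|Q| = 3 by lia.
have E4 : 3 < #|Q| -> #|Q| <= 4 -> #|Q| = 4 by lia.
have [a ia] := injective_letter.
have [/E2 ->|Q3] := leqP #|Q| 2.
  (* With two states, the constant map to [f] forces a letter moving [o], which an injective letter
     cannot do. *)
  have /mono_word[x _ xE] := mono_maps_const_f.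
  have [b bo] : exists b, d b o <> o.
    apply: contrapT => H; have runo y : run d y o = o.
      elim: y => //= b y IH; have -> : d b o = o by apply: contrapT => bo; apply: H; exists b.
      exact: IH.
    by move: (xE o); rewrite ffunE runo => /eqP; rewrite eq_sym (negPf o_neq_f).
  apply: (uniq_le [:: a; b]); rewrite /= inE andbT; apply/eqP=> ab.
  by apply: bo; rewrite -ab inj_fix.
have [i ii] : exists i, i \in inner o f by apply/card_gt0P; rewrite cQ subn_gt0.
have /andP[io fi] : (i != o) && (i != f) by rewrite -innerE.
(* The letter [c] merges an inner state with [o], and [e] merges one with [f]. *)
have [c [p [q [mc iq po pf]]]] := merging_letter ii io.
have [e [p' [q' [me iq' po' pf']]]] := merging_letter ii fi.
have ce : c != e.
  apply/eqP=> ce; rewrite -ce in me; have [E _] := merges_only_same_kind iq iq' mc me.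
  by move: E; rewrite po po' eqxx eq_sym (negPf o_neq_f).
have ic x : injective (d x) -> x != c.
  by move=> ix; apply/eqP=> E; apply: (inj_not_merges x p q); rewrite // E.
have ie x : injective (d x) -> x != e.
  by move=> ix; apply/eqP=> E; apply: (inj_not_merges x p' q'); rewrite // E.
(* With one inner state, a lifting letter may coincide with [e], so it is not counted. *)
have [/(E3 Q3) ->|Q4] := leqP #|Q| 3.
  by apply: (uniq_le [:: a; c; e]); rewrite /= !inE negb_or ic // ie // ce.
have I2 : 1 < #|inner o f| by rewrite cQ ltn_subRL.
have [r [s [ir is' rs]]] := card_gt1P I2.
have /andP[so sf] : (s != o) && (s != f) by rewrite -innerE.
(* The letter [g] merges two inner states. *)
have [g [p2 [q2 [mg iq2 po2 pf2]]]] := merging_letter ir rs.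
have cg : c != g.
  apply/eqP=> E; rewrite -E in mg; have [E' _] := merges_only_same_kind iq iq2 mc mg.
  by move: E'; rewrite po po2 eqxx (negPf so).
have eg : e != g.
  apply/eqP=> E; rewrite -E in mg; have [_ E'] := merges_only_same_kind iq' iq2 me mg.
  by move: E'; rewrite pf' pf2 eqxx (negPf sf).
have ig x : injective (d x) -> x != g.
  by move=> ix; apply/eqP=> E; apply: (inj_not_merges x p2 q2); rewrite // E.
(* The letter [l] moves [o] to an inner state, which neither an injective letter nor a letter
   merging a single pair does. *)
have [l il] := lifting_letter ii.
have lm x p3 q3 : merges_only (d x) p3 q3 -> x != l.
  by move=> mx; apply/eqP=> E; move: (merges_only_fix_o I2 mx); rewrite E il.
have li x : injective (d x) -> x != l.
  by move=> ix; apply/eqP=> E; move: il; rewrite -E inj_fix // innerE eqxx.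
have [/(E4 Q4) ->|Q5] := leqP #|Q| 4.
  apply: (uniq_le [:: a; c; e; g; l]); rewrite /= !inE !negb_or.
  by rewrite (ic _ ia) (ie _ ia) (ig _ ia) (li _ ia) ce cg eg
    (lm _ _ _ mc) (lm _ _ _ me) (lm _ _ _ mg).
have [|a1 [a2 [a12 i1 i2]]] := two_injective_letters; first by rewrite cQ ltn_subRL.
have -> : min_alpha #|Q| = 6 by case: #|Q| Q5 => [|[|[|[|[|]]]]].
apply: (uniq_le [:: a1; a2; c; e; g; l]); rewrite /= !inE !negb_or a12.
rewrite !(ic _ i1, ic _ i2, ie _ i1, ie _ i2, ig _ i1, ig _ i2, li _ i1, li _ i2).
by rewrite ce cg eg (lm _ _ _ mc) (lm _ _ _ me) (lm _ _ _ mg).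
Qed.

Lemma run_mono x p q : le p q -> le (run d x p) (run d x q).
Proof.
elim: x p q => //= a x IH p q pq; apply: IH.
by case/mono_mapsP: (letter_mono a) => _; apply.
Qed.

(** * The ideal recognised at the top *)

Definition top_language : language S := fun w => run d w o = f.

Lemma run_top x : run d x f = f.
Proof. by elim: x => //= a x IH; case/mono_mapsP: (letter_mono a) => ->. Qed.

Lemma top_language_dfa : minimal_dfa d top_language o [set f].
Proof.
have fo : (f == o) = false by rewrite eq_sym (negPf o_neq_f).
split=> [w|q|p q pq]; first by rewrite inE; split=> /eqP.
  have [->|qo] := eqVneq q o; first by exists [::].
  have [->|qf] := eqVneq q f.
    by have /mono_word[x _ xE] := mono_maps_const_f; exists x; rewrite -xE ffunE.
  have /mono_word[x _ xE] : [ffun z => if z == f then f else q] \in mono_maps le f.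
    apply: (@mono_maps_two_valued _ q) => [|||z];
      rewrite ?innerE ?qo ?ffunE ?eqxx ?(negPf o_neq_f) //.
    by case: eqP; [right|left].
  by exists x; rewrite -xE ffunE (negPf o_neq_f).
(* The map sending [r] and [f] to [f] and all else to [o] is the action of a word, which is accepted
   from [r] and [f] only. *)
have sep r s : r != o -> (forall x, (run d x r \in [set f]) = (run d x s \in [set f])) ->
    s = r \/ s = f.
  move=> ro rs; have /mono_word[x _ xE] :
      [ffun z => if (z == f) || (z == r) then f else o] \in mono_maps le f.
    by apply: mono_maps_fix; rewrite ffunE ?eqxx // (negPf o_neq_f) eq_sym (negPf ro).
  have [->|sr] := eqVneq s r; first by left.
  have [->|sf] := eqVneq s f; first by right.
  move: (rs x); rewrite -!xE !ffunE !inE (negPf sr) (negPf sf) (eqxx r) orbT /=.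
  by rewrite eqxx (negPf o_neq_f).
have [po|po] := eqVneq p o; have [qo|qo] := eqVneq q o.
- by rewrite po qo.
- by case: (sep q p qo) => // pf; rewrite -pf po eqxx in fo.
- by case: (sep p q po) => // qf; rewrite -qf qo eqxx in fo.
- by case: (sep p q po pq) => [-> //|qf]; case: (sep q p qo) => // ->; rewrite qf.
Qed.

(** As [o] lies below [run d u o], a word leading from [o] to [f] also leads from there to [f],
    which is absorbing. *)
Lemma top_language_ideal : two_sided_ideal top_language.
Proof.
have [_ acc _] := top_language_dfa; split; first exact: acc.
move=> w; split=> [Lw|[u [x [v [-> Lx]]]]].
  by exists [::], w, [::]; rewrite cats0.
rewrite /top_language !run_cat.
have -> : run d x (run d u o) = f; last exact: run_top.
by apply: le_anti; rewrite le_f -{1}[f]Lx run_mono.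
Qed.

End GeneratorCount.

(** * Generating the monotone maps of a flat poset *)

Definition seq_comp (Q : finType) (s t : {ffun Q -> Q}) : {ffun Q -> Q} :=
  [ffun z => t (s z)].

Lemma seq_compE (Q : finType) (s t : {ffun Q -> Q}) z : seq_comp s t z = t (s z).
Proof. exact: ffunE. Qed.

Lemma redirectE (Q : finType) (x y z : Q) : redirect x y z = if z == x then y else z.
Proof. exact: ffunE. Qed.

Lemma letters_of_generators (S : finType) (T : eqType) (gs : seq T) :
  0 < size gs -> size gs <= #|S| ->
  exists2 d : S -> T, forall a, d a \in gs & forall g, g \in gs -> exists a, d a = g.
Proof.
(* Letters ranked beyond the end of the list get the default [g0], so surplus letters repeat a
   generator. *)
case: gs => // g0 gs _ gsS; exists (fun a => nth g0 (g0 :: gs) (enum_rank a)) => [a|g].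
  have [lt|ge] := ltnP (enum_rank a) (size (g0 :: gs)); first exact: mem_nth.
  by rewrite nth_default // mem_head.
move=> /[dup] gin; rewrite -index_mem => lt.
exists (enum_val (Ordinal (leq_trans lt gsS))).
by rewrite enum_valK nth_index.
Qed.

Lemma trans_semigroup_generated (S Q : finType) (d : S -> {ffun Q -> Q})
    (W : {set {ffun Q -> Q}}) :
  (forall s t, s \in W -> t \in W -> seq_comp s t \in W) -> (forall a, d a \in W) ->
  (forall G : {ffun Q -> Q} -> Prop, (forall a, G (d a)) ->
     (forall s t, G s -> G t -> G (seq_comp s t)) -> forall t, t \in W -> G t) ->
  trans_semigroup d = W.
Proof.
move=> Wc dW gen; apply/setP=> t; apply/trans_semigroupP/idP => [[x x0 ->]|].
  case: x x0 => // a x _; elim: x a => [|b x IH] a.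
    by have -> : trans d [:: a] = d a by apply/ffunP=> q; rewrite ffunE.
  have -> : trans d [:: a, b & x] = seq_comp (d a) (trans d (b :: x)).
    by apply/ffunP=> q; rewrite !ffunE.
  exact: Wc.
apply: (gen (fun t => exists2 x, x <> [::] & t = trans d x)).
  by move=> a; exists [:: a] => //; apply/ffunP=> q; rewrite ffunE.
move=> _ _ [x x0 ->] [y y0 ->].
exists (x ++ y); first by case: x x0.
by apply/ffunP=> q; rewrite !ffunE run_cat.
Qed.

Lemma mono_maps_comp (Q : finType) (le : rel Q) (f : Q) s t :
  s \in mono_maps le f -> t \in mono_maps le f -> seq_comp s t \in mono_maps le f.
Proof.
case/mono_mapsP=> sf sm /mono_mapsP[tf tm]; apply/mono_mapsP.
by split=> [|x y xy]; rewrite !ffunE ?sf //; apply/tm/sm.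
Qed.

Section Generation.

Variables (Q : finType) (le : rel Q) (o f : Q).
Hypotheses (le_anti : antisymmetric le) (le_o : forall x, le o x) (le_f : forall x, le x f).
Hypotheses (o_neq_f : o != f) (anti : inner_antichain le o f).
Variable G : {ffun Q -> Q} -> Prop.
Hypothesis Gcomp : forall s t, G s -> G t -> G (seq_comp s t).
Hypothesis Gid : G [ffun z => z].
Hypothesis Gtperm : forall x y, x \in inner o f -> y \in inner o f -> x != y ->
  G [ffun z => tperm x y z].
Hypothesis Gredirect : forall x y, x \in inner o f -> x != y -> G (redirect x y).

(* Each step makes one more point fixed: split off a [redirect] if [t x] is
   already fixed by [t], and a transposition otherwise. *)
Lemma generated_fix (t : {ffun Q -> Q}) : t o = o -> t f = f -> G t.
Proof.
move cE: #|[set x | t x != x]| => k; elim/ltn_ind: k t cE => k IH t cE to tf.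
case: (pickP (fun x => t x != x)) => [x tx|fixt]; last first.
  suff -> : t = [ffun z => z] by [].
  by apply/ffunP=> z; rewrite ffunE; apply/eqP; apply/negPn/negP; rewrite fixt.
have ix : x \in inner o f.
  by rewrite !inE negb_or; apply/andP; split; apply: contra tx => /eqP ->; rewrite ?to ?tf.
have [ty|ty] := eqVneq (t (t x)) (t x).
  pose t' := [ffun z => if z == x then x else t z].
  have -> : t = seq_comp (redirect x (t x)) t'.
    apply/ffunP=> z; rewrite !ffunE; have [->|/negPf zx] := eqVneq z x.
      by rewrite (negPf tx).
    by rewrite zx.
  apply: Gcomp; first by apply: Gredirect; rewrite // eq_sym.
  apply: (IH #|[set z | t' z != z]|) => //.
  - rewrite -cE; apply/proper_card/properP; split.
      by apply/subsetP=> z; rewrite !inE ffunE; have [->|//] := eqVneq z x; rewrite eqxx.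
    by exists x; rewrite !inE ?tx // ffunE eqxx eqxx.
  - by rewrite ffunE to; case: ifP => // /eqP.
  - by rewrite ffunE tf; case: ifP => // /eqP.
have iy : t x \in inner o f.
  by rewrite !inE negb_or; apply/andP; split; apply: contra ty => /eqP ->; rewrite ?to ?tf.
pose p := tperm x (t x); pose t' := [ffun z => p (t z)].
have pfix z : z \notin inner o f -> p z = z.
  by move=> iz; apply: tpermD; apply: contraNneq iz => <-.
have -> : t = seq_comp t' [ffun z => p z].
  by apply/ffunP=> z; rewrite !ffunE tpermK.
apply: Gcomp; last by apply: Gtperm; rewrite // eq_sym.
apply: (IH #|[set z | t' z != z]|) => //.
- rewrite -cE; apply/proper_card/properP; split.
    apply/subsetP=> z; rewrite !inE ffunE; apply: contra => /eqP tz.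
    by rewrite tz; apply/eqP/tpermD; apply/eqP=> E; move: tx ty; rewrite ?E tz ?eqxx.
  by exists x; rewrite !inE ?tx // ffunE /p tpermR eqxx.
- by rewrite ffunE to pfix // !inE eqxx.
- by rewrite ffunE tf pfix // !inE eqxx orbT.
Qed.

Variable i : Q.
Hypotheses (ii : i \in inner o f) (Glift : G [ffun z => if z == f then f else i]).

(** The cases follow [t o]. If it is [f], then [t] is constant: lift to [i], then redirect [i] to
    [f]. If it is inner, [t] takes only the values [t o] and [f]: send their preimages to [o] and
    [f], lift to [i], redirect [i] to [t o]. *)
Lemma generated_mono_maps (t : {ffun Q -> Q}) : t \in mono_maps le f -> G t.
Proof.
move=> tW; have /mono_mapsP[tf tm] := tW.
have fo : (f == o) = false by rewrite eq_sym (negPf o_neq_f).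
have : (i != o) && (i != f) by rewrite -negb_or; move: ii; rewrite !inE.
case/andP=> io fi.
have [to|to] := eqVneq (t o) o; first exact: generated_fix.
have [tof|tof] := eqVneq (t o) f.
  have -> : t = seq_comp [ffun z => if z == f then f else i] (redirect i f).
    apply/ffunP=> z; rewrite !ffunE; have -> : t z = f.
      by apply: le_anti; rewrite le_f -{1}tof tm.
    by case: (z == f); [case: eqP | rewrite eqxx].
  by apply: Gcomp => //; apply: Gredirect.
have ito : t o \in inner o f by rewrite !inE negb_or to.
pose t1 := [ffun z => if t z == f then f else o].
have -> : t = seq_comp (seq_comp t1 [ffun z => if z == f then f else i]) (redirect i (t o)).
  apply/ffunP=> z; rewrite !ffunE.
  case: (mono_maps_inner_image le_anti le_o anti z tW ito) => ->.
    by rewrite (negPf tof) (negPf o_neq_f) eqxx.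
  by rewrite !eqxx eq_sym (negPf fi).
apply: Gcomp; first apply: Gcomp => //.
  by apply: generated_fix; rewrite ffunE ?tf ?eqxx ?(negPf tof).
have [<-|iE] := eqVneq i (t o); last exact: Gredirect.
suff -> : redirect i i = [ffun z => z] by [].
by apply/ffunP=> z; rewrite !ffunE; case: eqP.
Qed.

End Generation.

(** * The flat poset and its atom permutations *)

Section FlatPoset.

Variable m : nat.

(* [None] is the top and [Some None] the bottom of the flat order on ['I_m]. *)
Local Notation flat := (option (option 'I_m)).

Definition bot : flat := Some None.
Definition top : flat := None.
Definition atom (i : 'I_m) : flat := Some (Some i).
Definition flat_le : rel flat := fun x y => [|| x == y, x == bot | y == top].

Lemma card_flat : #|{: flat}| = m.+2.
Proof. by rewrite !card_option card_ord. Qed.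

Lemma atom_inj : injective atom.
Proof. by move=> i j []. Qed.

Lemma inner_flatP (x : flat) : x \in inner bot top -> exists i, x = atom i.
Proof. by case: x => [[i|]|]; rewrite !inE //; exists i. Qed.

Lemma atom_inner i : atom i \in inner bot top.
Proof. by rewrite !inE. Qed.

Lemma flat_le_refl : reflexive flat_le.
Proof. by move=> x; rewrite /flat_le eqxx. Qed.

Lemma flat_le_anti : antisymmetric flat_le.
Proof.
move=> x y /andP[/or3P[/eqP //|/eqP->|/eqP->] /or3P[/eqP //|/eqP yE|/eqP yE]] //.
Qed.

Lemma flat_le_bot x : flat_le bot x.
Proof. by rewrite /flat_le eqxx orbT. Qed.

Lemma flat_le_top x : flat_le x top.
Proof. by rewrite /flat_le eqxx !orbT. Qed.

Lemma bot_neq_top : bot != top.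
Proof. by []. Qed.

Lemma flat_antichain : inner_antichain flat_le bot top.
Proof. by move=> x y /inner_flatP[i ->] /inner_flatP[j ->] /or3P[/eqP|/eqP|/eqP]. Qed.

Definition atom_perm (s : 'S_m) : {ffun flat -> flat} :=
  [ffun z : flat => if z is Some (Some i) then atom (s i) else z].

Lemma atom_permM s t : atom_perm (s * t)%g = seq_comp (atom_perm s) (atom_perm t).
Proof. by apply/ffunP=> -[[i|]|]; rewrite !ffunE //= permM. Qed.

Lemma atom_perm1 : atom_perm 1%g = [ffun z => z].
Proof. by apply/ffunP=> -[[i|]|]; rewrite !ffunE //= perm1. Qed.

Lemma atom_permK s : cancel (atom_perm s) (atom_perm s^-1%g).
Proof. by case=> [[i|]|]; rewrite !ffunE //= permK. Qed.

Lemma atom_perm_tperm i j : [ffun z => tperm (atom i) (atom j) z] = atom_perm (tperm i j).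
Proof.
apply/ffunP=> z; rewrite !ffunE; case: z => [[k|]|]; try by rewrite tpermD.
by rewrite -/(atom k) -(inj_tperm _ _ _ atom_inj).
Qed.

(** Conjugation by atom permutations reduces all redirections to a few representatives. *)
Lemma redirect_conj s x y : redirect x y = seq_comp (seq_comp (atom_perm s)
  (redirect (atom_perm s x) (atom_perm s y))) (atom_perm s^-1%g).
Proof.
apply/ffunP=> z; rewrite !seq_compE !redirectE.
by rewrite (inj_eq (can_inj (atom_permK s))); case: eqP => _; rewrite atom_permK.
Qed.

Definition lift_to (i : 'I_m) : {ffun flat -> flat} := [ffun z => if z == top then top else atom i].

End FlatPoset.

(** The circular shift and an adjacent transposition generate the symmetric group. On two points
    they coincide, which saves a letter for four states. *)
Lemma shift_generates k : exists c : 'S_k.+2,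
  <<[set tperm ord0 1%R; c]>>%g = [set: 'S_k.+2] /\ (k = 0 -> c = tperm ord0 1%R).
Proof.
exists (perm (GRing.addrI (1%R : 'I_k.+2))); split.
  by apply: gen_tpermn_circular_shift; rewrite GRing.subr0 coprimen1.
move=> k0; subst k; apply/permP=> -[[|[|//]] lt]; rewrite permE; apply: val_inj.
  by rewrite -[X in tperm _ _ X](_ : ord0 = _) ?tpermL //; apply: val_inj.
by rewrite -[X in tperm _ _ X](_ : 1%R = _) ?tpermR //; apply: val_inj.
Qed.

Section FlatGeneration.

Variable k : nat.
Local Notation m := k.+2.
Local Notation flat := (option (option 'I_m)).
Local Notation x0 := (atom (ord0 : 'I_m)).
Local Notation x1 := (atom (1%R : 'I_m)).

Variable c : 'S_m.
Hypothesis cgen : <<[set tperm ord0 1%R; c]>>%g = [set: 'S_m].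
Variable G : {ffun flat -> flat} -> Prop.
Hypothesis Gcomp : forall s t, G s -> G t -> G (seq_comp s t).
Hypotheses (Gtr : G (atom_perm (tperm ord0 1%R))) (Gc : G (atom_perm c)).

Lemma generated_perm s : G (atom_perm s).
Proof.
have gA : group_set [set t : 'S_m | `[< G (atom_perm t) >]].
  apply/group_setP; split=> [|t u]; rewrite !inE.
    (* The identity is obtained as the square of the transposition. *)
    by apply/asboolP; rewrite -(tperm2 ord0 1%R) atom_permM; apply: Gcomp.
  by move=> /asboolP Gt /asboolP Gu; apply/asboolP; rewrite atom_permM; apply: Gcomp.
suff: s \in Group gA by rewrite inE => /asboolP.
apply: subsetP (in_setT s); rewrite -cgen gen_subG; apply/subsetP=> t.
by rewrite !inE => /orP[]/eqP ->; apply/asboolP.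
Qed.

Hypotheses (G01 : G (redirect x0 x1)) (G0b : G (redirect x0 (bot _))).
Hypotheses (G0t : G (redirect x0 (top _))).

Lemma generated_redirect i y : atom i != y -> G (redirect (atom i) y).
Proof.
(* Some permutation moves [i] to [ord0] and, if [y] is an atom, [y] to [x1]. *)
move=> iy; have [s [si sy]] : exists s : 'S_m, s i = ord0 /\
    atom_perm s y \in [:: x1; bot _; top _].
  case: y iy => [[j|]|] iy; last 2 first.
  - by exists (tperm i ord0); rewrite tpermL ffunE.
  - by exists (tperm i ord0); rewrite tpermL ffunE.
  have ij : i != j by apply: contra iy => /eqP ->.
  have j0 : tperm i ord0 j != ord0 by rewrite -[X in _ != X](tpermL i) (inj_eq perm_inj) eq_sym.
  exists (tperm i ord0 * tperm (tperm i ord0 j) 1%R)%g.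
  split; first by rewrite permM tpermL (tpermD j0).
  by rewrite ffunE permM tpermL mem_head.
rewrite (redirect_conj s); have -> : atom_perm s (atom i) = x0 by rewrite ffunE /= si.
apply: Gcomp; last exact: generated_perm; apply: Gcomp; first exact: generated_perm.
by move: sy; rewrite !inE => /or3P[]/eqP ->.
Qed.

Hypothesis Glift : G (lift_to ord0).

Lemma generated_flat t : t \in mono_maps (@flat_le m) (top m) -> G t.
Proof.
apply: (generated_mono_maps (@flat_le_anti m) (@flat_le_bot m) (@flat_le_top m)
  (bot_neq_top m) (@flat_antichain m) Gcomp _ _ _ (atom_inner ord0) Glift).
- by rewrite -atom_perm1; apply: generated_perm.
- move=> _ _ /inner_flatP[i ->] /inner_flatP[j ->] _.
  by rewrite atom_perm_tperm; apply: generated_perm.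
- by move=> _ y /inner_flatP[i ->]; apply: generated_redirect.
Qed.

End FlatGeneration.

Lemma flat_mono_fix m (t : {ffun option (option 'I_m) -> option (option 'I_m)}) :
  t (bot m) = bot m -> t (top m) = top m -> t \in mono_maps (@flat_le m) (top m).
Proof.
exact: (mono_maps_fix (@flat_le_refl m) (@flat_le_anti m) (@flat_le_bot m)
  (@flat_le_top m) (bot_neq_top m) (@flat_antichain m)).
Qed.

Lemma flat_mono_lift m (i : 'I_m) : lift_to i \in mono_maps (@flat_le m) (top m).
Proof.
apply: (mono_maps_two_valued (@flat_le_refl m) (@flat_le_anti m) (@flat_le_bot m)
  (@flat_le_top m) (bot_neq_top m) (@flat_antichain m) (atom_inner i)); rewrite ?ffunE //.
by move=> z; rewrite ffunE; case: eqP; [right|left].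
Qed.

(** Generation is phrased as an induction principle, so that no words over the generators are
    needed. *)
Definition generates (Q : finType) (gs : seq {ffun Q -> Q}) (W : {set {ffun Q -> Q}}) : Prop :=
  {subset gs <= W} /\
  forall G : {ffun Q -> Q} -> Prop, (forall g, g \in gs -> G g) ->
    (forall s t, G s -> G t -> G (seq_comp s t)) -> forall t, t \in W -> G t.

Lemma flat_generators0 : exists2 gs,
  size gs = 2 & generates gs (mono_maps (@flat_le 0) (top 0)).
Proof.
exists [:: [ffun z => z]; [ffun=> top 0]] => //; split.
  move=> g; rewrite mem_seq2 => /orP[]/eqP ->; last first.
    exact: (mono_maps_const_f (top 0) (@flat_le_refl 0)).
  by apply: flat_mono_fix; rewrite ffunE.
move=> G Ggs _ t /mono_mapsP[tf _]; apply: Ggs; rewrite !inE.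
have [tb|tb] : t (bot 0) = bot 0 \/ t (bot 0) = top 0.
  by case: (t (bot 0)) => [[[]|]|]; [|left|right].
- by apply/orP; left; apply/eqP/ffunP=> -[[[]|]|] //; rewrite ffunE.
- by apply/orP; right; apply/eqP/ffunP=> -[[[]|]|] //; rewrite ffunE.
Qed.

(* The map [bot -> atom -> top] yields both missing generators when composed
   with the redirection of the atom to [bot]. *)
Lemma flat_generators1 : exists2 gs,
  size gs = 3 & generates gs (mono_maps (@flat_le 1) (top 1)).
Proof.
pose x := atom (ord0 : 'I_1).
pose g : {ffun option (option 'I_1) -> option (option 'I_1)} :=
  [ffun z => if z == bot 1 then x else top 1].
have all1 i : atom (i : 'I_1) = x by rewrite ord1.
exists [:: [ffun z => z]; redirect x (bot 1); g] => //; split.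
  move=> h; rewrite mem_seq3 => /or3P[]/eqP ->.
  - by apply: flat_mono_fix; rewrite ffunE.
  - by apply: flat_mono_fix; rewrite redirectE.
  - apply: (mono_maps_two_valued (@flat_le_refl 1) (@flat_le_anti 1) (@flat_le_bot 1)
      (@flat_le_top 1) (bot_neq_top 1) (@flat_antichain 1) (atom_inner ord0)); rewrite ?ffunE //.
    by move=> z; rewrite ffunE; case: eqP; [left|right].
move=> G Ggs Gcomp t tW.
have Gid : G [ffun z => z] by apply: Ggs; rewrite mem_head.
have Gb : G (redirect x (bot 1)) by apply: Ggs; rewrite !inE eqxx orbT.
have Gg : G g by apply: Ggs; rewrite !inE eqxx !orbT.
have Gt : G (redirect x (top 1)).
  suff -> : redirect x (top 1) = seq_comp g (redirect x (bot 1)) by apply: Gcomp.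
  by apply/ffunP=> -[[i|]|]; rewrite seq_compE !redirectE ffunE // -/(atom i) all1 ?eqxx.
have Gl : G (lift_to ord0).
  suff -> : lift_to ord0 = seq_comp (redirect x (bot 1)) g by apply: Gcomp.
  by apply/ffunP=> -[[i|]|]; rewrite seq_compE redirectE !ffunE // -/(atom i) all1 ?eqxx.
apply: (generated_mono_maps (@flat_le_anti 1) (@flat_le_bot 1) (@flat_le_top 1)
  (bot_neq_top 1) (@flat_antichain 1) Gcomp Gid _ _ (atom_inner ord0) Gl tW).
- by move=> _ _ /inner_flatP[i ->] /inner_flatP[j ->]; rewrite !all1 eqxx.
- move=> _ y /inner_flatP[i ->]; rewrite all1.
  by case: y => [[j|]|] => //; rewrite -/(atom j) all1 eqxx.
Qed.

Lemma flat_generators m : exists2 gs,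
  size gs = min_alpha m.+2 & generates gs (mono_maps (@flat_le m) (top m)).
Proof.
case: m => [|[|k]]; [exact: flat_generators0 | exact: flat_generators1 |].
have [c [cgen c0]] := shift_generates k.
pose x0 := atom (ord0 : 'I_k.+2); pose x1 := atom (1%R : 'I_k.+2).
pose gs := [:: atom_perm (tperm ord0 1%R); redirect x0 x1; redirect x0 (bot _);
  redirect x0 (top _); lift_to ord0].
have gsW : {subset gs <= mono_maps (@flat_le k.+2) (top k.+2)}.
  move=> g; rewrite in_cons mem_seq4 => /orP[|/or4P[]] /eqP ->; try exact: flat_mono_lift;
    by apply: flat_mono_fix; rewrite ffunE.
have gen (G : _ -> Prop) : G (atom_perm c) -> (forall g, g \in gs -> G g) ->
    (forall s t, G s -> G t -> G (seq_comp s t)) ->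
    forall t, t \in mono_maps (@flat_le k.+2) (top k.+2) -> G t.
  move=> Gc Ggs Gcomp; apply: (generated_flat cgen Gcomp) => //; apply: Ggs;
    by rewrite !inE eqxx ?orbT.
(* For [k = 0] the shift [c] is already in [gs]; otherwise it is a sixth generator. *)
have -> : min_alpha k.+4 = if k == 0 then 5 else 6 by case: (k).
case: eqP => [k0|_].
  exists gs => //; split=> // G Ggs; apply: gen => //.
  by rewrite c0 //; apply: Ggs; rewrite mem_head.
exists (atom_perm c :: gs) => //; split=> [g|G Ggs].
  rewrite in_cons => /orP[/eqP ->|]; last exact: gsW.
  by apply: flat_mono_fix; rewrite ffunE.
apply: gen; first by apply: Ggs; rewrite mem_head.
by move=> g gin; apply: Ggs; rewrite inE gin orbT.
Qed.

(** * The syntactic complexity of ideals and factor-closed languages *)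

Lemma ideal_bound_reached (S : finType) n : 1 < n -> min_alpha n <= #|S| ->
  exists L : language S,
    [/\ two_sided_ideal L, kappa_is L n & sigma_is L (sigma_bound n)].
Proof.
case: n => [|[|m]] // _; have [gs <- [gsW gen]] := flat_generators m => gsS.
have gs0 : 0 < size gs.
  (* An empty list would generate only the empty set, by the predicate that is always false. *)
  case: gs gen {gsW gsS} => // gen; exfalso.
  by apply: (gen (fun=> False) _ _ _ (mono_maps_const_f (top m) (@flat_le_refl m))).
have [d din dall] := letters_of_generators gs0 gsS.
have full : trans_semigroup d = mono_maps (@flat_le m) (top m).
  apply: trans_semigroup_generated => [s t|a|G Gd Gcomp].
  - exact: mono_maps_comp.
  - exact: gsW.
  - by apply: gen => // g /dall[a <-].
pose L := top_language (bot m) (top m) d.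
have dfaL : minimal_dfa d L (bot m) [set top m].
  exact: (top_language_dfa (@flat_le_refl m) (@flat_le_anti m) (@flat_le_bot m)
    (@flat_le_top m) (bot_neq_top m) (@flat_antichain m) full).
exists L; split.
- exact: (top_language_ideal (@flat_le_refl m) (@flat_le_anti m) (@flat_le_bot m)
    (@flat_le_top m) (bot_neq_top m) (@flat_antichain m) full).
- by rewrite -(card_flat m); apply: minimal_dfa_kappa dfaL.
- apply/(minimal_dfa_sigma dfaL); rewrite full -(card_flat m).
  exact: (card_mono_maps_antichain (@flat_le_refl m) (@flat_le_anti m) (@flat_le_bot m)
    (@flat_le_top m) (bot_neq_top m) (@flat_antichain m)).
Qed.

Lemma ideal_sigma (S : finType) (L : language S) n : 1 < n ->
  two_sided_ideal L -> kappa_is L n ->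
  exists2 s, sigma_is L s & s <= sigma_bound n /\ (s = sigma_bound n -> min_alpha n <= #|S|).
Proof.
move=> n1 idealL /kappa_minimal_dfa[d [o [F dfaL]]].
have [f FE le_f] := ideal_top dfaL idealL.
have [LF acc red] := dfaL.
have le_refl := quot_le_refl d F; have le_anti := quot_le_anti dfaL.
have le_tr := @quot_le_trans _ _ d F; have le_o := quot_le_initial dfaL idealL.
have o_neq_f : o != f.
  (* If [o = f], antisymmetry squeezes all states into one. *)
  apply/eqP=> of_eq; have eqf q : q = f by apply: le_anti; rewrite le_f -of_eq le_o.
  have : #|'I_n| <= #|[set f]| by apply/subset_leq_card/subsetP=> q _; rewrite inE (eqf q).
  by rewrite card_ord cards1 leqNgt n1.
have sub : trans_semigroup d \subset mono_maps (quot_le d F) f.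
  apply/subsetP=> _ /trans_semigroupP[x _ ->]; apply/mono_mapsP; split; last first.
    by move=> p q pq; rewrite !ffunE; apply: quot_le_run.
  rewrite ffunE; apply: le_anti; rewrite le_f /=.
  apply/asboolP=> y; have [w wf] := acc f.
  have Lw : L w by apply/LF; rewrite wf FE inE.
  move=> _; rewrite -wf -!run_cat; apply/LF.
  by rewrite -?catA; case: idealL => _ idL; apply/idL; exists [::], w, (x ++ y).
have := card_mono_maps_le le_refl le_anti le_tr le_o le_f o_neq_f.
rewrite card_ord => Wle.
exists #|trans_semigroup d|; first exact/(minimal_dfa_sigma dfaL).
split=> [|sE]; first exact: leq_trans (subset_leq_card sub) Wle.
(* Attaining the bound forces the inclusion [sub] to be an equality. *)
have full : trans_semigroup d = mono_maps (quot_le d F) f.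
  by apply/eqP; rewrite eqEcard sub sE.
have anti : inner_antichain (quot_le d F) o f.
  apply: (mono_maps_extremal le_refl le_anti le_tr le_o o_neq_f).
  by rewrite card_ord -full.
by have := min_alpha_le_letters le_refl le_anti le_o le_f o_neq_f anti full; rewrite card_ord.
Qed.

(** * Passing to complements *)

Section Complement.

Variables (S : finType) (L : language S).

Definition complement : language S := fun w => ~ L w.

Lemma quot_eq_complement u v : quot_eq complement u v <-> quot_eq L u v.
Proof.
by split=> uv x; have := uv x; rewrite /complement; case: (pselect (L (u ++ x)));
  case: (pselect (L (v ++ x))); tauto.
Qed.

Lemma synt_cong_complement x y : synt_cong complement x y <-> synt_cong L x y.
Proof.
by split=> xy u v; have := xy u v; rewrite /complement; case: (pselect (L (u ++ x ++ v)));
  case: (pselect (L (u ++ y ++ v))); tauto.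
Qed.

Lemma kappa_complement n : kappa_is complement n <-> kappa_is L n.
Proof.
split=> -[w [inj all]]; exists w; split=> [i j /quot_eq_complement|u]; try exact: inj;
  by have [i /quot_eq_complement] := all u; exists i.
Qed.

Lemma sigma_complement m : sigma_is complement m <-> sigma_is L m.
Proof.
split=> -[w [w0 [inj all]]]; exists w; split=> //;
  (split=> [i j /synt_cong_complement|x x0]; first exact: inj);
  by have [i /synt_cong_complement] := all x x0; exists i.
Qed.

Lemma complement_ideal : two_sided_ideal L -> factor_closed complement.
Proof. by case=> _ idL u x v nL Lx; apply: nL; apply/idL; exists u, x, v. Qed.

(** Nonemptiness comes from [1 < n]: if the complement were empty, all quotients of [L] would be
    equal. *)
Lemma complement_factor_closed n :
  1 < n -> factor_closed L -> kappa_is L n -> two_sided_ideal complement.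
Proof.
move=> n1 fc [w [inj _]]; split; last first.
  move=> x; split=> [nL|[u [y [v [-> nL]]]] /fc //].
  by exists [::], x, [::]; rewrite cats0.
apply: contrapT => H.
have Lall x : L x by apply: contrapT => nL; apply: H; exists x.
by have /inj[] : quot_eq L (w (Ordinal (ltnW n1))) (w (Ordinal n1)) by move=> x; split.
Qed.

End Complement.

Theorem theorem6 :
  forall (S : finType), 0 < #|S| ->
  forall (n : nat), 1 < n ->
  forall b : bool,
    (* upper bound *)
    (forall L : language S, lang_class b L -> kappa_is L n ->
       exists m, sigma_is L m /\ m <= sigma_bound n) /\
    (* tightness *)
    (min_alpha n <= #|S| ->
       exists L : language S, lang_class b L /\ kappa_is L n /\
         sigma_is L (sigma_bound n)) /\
    (* alphabet sizes cannot be reduced *)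
    (#|S| < min_alpha n ->
       forall L : language S, lang_class b L -> kappa_is L n ->
         ~ sigma_is L (sigma_bound n)).
Proof.
move=> S _ n n1 b.
have key (L : language S) : lang_class b L -> kappa_is L n ->
    exists2 s, sigma_is L s & s <= sigma_bound n /\ (s = sigma_bound n -> min_alpha n <= #|S|).
  case: b => /= Lb kL; first exact: ideal_sigma.
  have [s /sigma_complement sL sP] :=
    ideal_sigma n1 (complement_factor_closed n1 Lb kL) (proj2 (kappa_complement L n) kL).
  by exists s.
split; first by move=> L Lb kL; have [s sL [sle _]] := key L Lb kL; exists s.
split=> [Sn|Sn L Lb kL sL].
  have [L [Li kL sL]] := ideal_bound_reached n1 Sn.
  case: b {key}; first by exists L.
  exists (complement L); split; first exact: complement_ideal.
  by split; [apply/kappa_complement | apply/sigma_complement].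
have [s sL' [_ sP]] := key L Lb kL.
(* Both values of sigma equal the size of one transition semigroup, hence agree. *)
have [d [o [F dfaL]]] := kappa_minimal_dfa kL.
move/(minimal_dfa_sigma dfaL): sL => sL; move/(minimal_dfa_sigma dfaL): sL' => sL'.
by move: Sn; rewrite ltnNge sP // -sL'.
Qed.
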